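(* Let $\Pi$ be a partition of $[n]$. Then for all integers $i\ge 1$, \[ \mathrm{Comp}_{n+i}(S_\Pi) = \begin{cases} S_{\Pi^{(i)}}, & \text{if } \delta_n\notin S_\Pi,\\ \langle S_{\Pi^{(i)}},\delta_{n+i}\rangle, & \text{if }\delta_n\in S_\Pi.\end{cases} \]
   Context: $S_n$ is the symmetric group on $[n]=\{1,\dots,n\}$; $\delta_n$ is $i\mapsto n+1-i$. For a partition $\Pi$ of $[n]$, $S_\Pi=\{\pi\in S_n: \pi(B)=B \text{ for all } B\in\Pi\}$. Let $\widehat{\Pi}$ be the coarsest partition of $[n]$ into intervals refining $\Pi$, with blocks $[1]_{\widehat\Pi}\ni 1$ and $[n]_{\widehat\Pi}\ni n$. Define partitions of $[n+1]$: $\widehat\Pi^{1}=\{B+1 : B\in\widehat\Pi,\,1\notin B\}\cup\{([1]_{\widehat\Pi}+1)\cup\{1\}\}$ and $\widehat\Pi^{n+1}=\{B: B\in\widehat\Pi,\, n\notin B\}\cup\{[n]_{\widehat\Pi}\cup\{n+1\}\}$; $\Pi'$ is their coarsest common refinement. Set $\Pi^{(1)}=\Pi'$ and $\Pi^{(i+1)}=(\Pi^{(i)})'$ (a partition of $[n+i+1]$). A permutation $\pi\in S_m$ involves $\tau\in S_n$ ($n\le m$) if there are indices $i_1<\dots<i_n$ with $\pi(i_j)<\pi(i_k)$ iff $\tau(j)<\tau(k)$ for all $j,k$; such $\tau$ is an $n$-pattern of $\pi$. For $S\subseteq S_n$, $\mathrm{Comp}_m(S)$ is the set of $\tau\in S_m$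 all of whose $n$-patterns belong to $S$. *)

(* Defs.v *)
(* The set [n] = {1, ..., n} is 'I_n, shifted to {0, ..., n-1}. *)
From HB Require Import structures.
From mathcomp Require Import all_boot all_fingroup.

Set Implicit Arguments.
Unset Strict Implicit.
Unset Printing Implicit Defensive.

Definition delta (n : nat) : {perm 'I_n} := perm (@rev_ord_inj n).

Definition stab_part (n : nat) (P : {set {set 'I_n}}) : {set {perm 'I_n}} :=
  [set s : {perm 'I_n} | [forall B in P, s @: B == B]].

Definition refines (n : nat) (Q P : {set {set 'I_n}}) : bool :=
  [forall B in Q, exists C in P, B \subset C].

Definition is_interval (n : nat) (B : {set 'I_n}) : bool :=
  [forall x in B, forall y in B, forall z : 'I_n, (x <= z <= y) ==> (z \in B)].

Definition is_coarsest (n : nat) (p : pred {set {set 'I_n}})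
    (P : {set {set 'I_n}}) : bool :=
  p P && [forall Q : {set {set 'I_n}}, p Q ==> refines Q P].

(* The default value set0 is irrelevant: see [hatP] and [common_refinementP]. *)
Definition coarsest (n : nat) (p : pred {set {set 'I_n}}) : {set {set 'I_n}} :=
  odflt set0 [pick P | is_coarsest p P].

Definition interval_refinement (n : nat) (P : {set {set 'I_n}}) :
    pred {set {set 'I_n}} :=
  [pred Q | [&& partition Q [set: 'I_n],
                [forall B in Q, is_interval B] & refines Q P]].

Definition hat (n : nat) (P : {set {set 'I_n}}) : {set {set 'I_n}} :=
  coarsest (interval_refinement P).

Definition is_common_refinement (n : nat) (P Q : {set {set 'I_n}}) :
    pred {set {set 'I_n}} :=
  [pred R | [&& partition R [set: 'I_n], refines R P & refines R Q]].

Definition common_refinement (n : nat) (P Q : {set {set 'I_n}}) :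
    {set {set 'I_n}} :=
  coarsest (is_common_refinement P Q).

Definition has_first (n : nat) (B : {set 'I_n}) : bool :=
  [exists x in B, x == 0 :> nat].

Definition has_last (n : nat) (B : {set 'I_n}) : bool :=
  [exists x in B, x.+1 == n].

(* [lift ord0 : 'I_n -> 'I_n.+1] is x |-> x + 1, and
   [lift ord_max : 'I_n -> 'I_n.+1] is the inclusion x |-> x. *)
Definition hat_first (n : nat) (P : {set {set 'I_n}}) : {set {set 'I_n.+1}} :=
  [set lift ord0 @: B | B : {set 'I_n} in hat P & ~~ has_first B]
  :|: [set (lift ord0 @: B) :|: [set ord0]
         | B : {set 'I_n} in hat P & has_first B].

Definition hat_last (n : nat) (P : {set {set 'I_n}}) : {set {set 'I_n.+1}} :=
  [set lift ord_max @: B | B : {set 'I_n} in hat P & ~~ has_last B]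
  :|: [set (lift ord_max @: B) :|: [set ord_max]
         | B : {set 'I_n} in hat P & has_last B].

Definition prime_part (n : nat) (P : {set {set 'I_n}}) : {set {set 'I_n.+1}} :=
  common_refinement (hat_first P) (hat_last P).

Fixpoint iter_part (n : nat) (P : {set {set 'I_n}}) (i : nat) :
    {set {set 'I_(i + n)}} :=
  match i with
  | 0 => P
  | j.+1 => prime_part (iter_part P j)
  end.

Definition involves (m n : nat) (s : {perm 'I_m}) (t : {perm 'I_n}) : bool :=
  [exists f : {ffun 'I_n -> 'I_m},
    [forall j : 'I_n, forall k : 'I_n, (j < k) ==> (f j < f k)] &&
    [forall j : 'I_n, forall k : 'I_n, (s (f j) < s (f k)) == (t j < t k)]].

Definition Comp (n m : nat) (S : {set {perm 'I_n}}) : {set {perm 'I_m}} :=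
  [set s : {perm 'I_m} | [forall t : {perm 'I_n}, involves s t ==> (t \in S)]].

Lemma coarsestP (n : nat) (p : pred {set {set 'I_n}}) :
  (exists P, is_coarsest p P) -> is_coarsest p (coarsest p).
Proof.
case=> P hP; rewrite /coarsest; case: pickP => [Q //|h].
by move: (h P); rewrite hP.
Qed.

Lemma coarsest_of_equiv (n : nat) (p : pred {set {set 'I_n}}) (r : rel 'I_n) :
  equivalence_rel r ->
  p (equivalence_partition r [set: 'I_n]) ->
  (forall Q, p Q -> partition Q [set: 'I_n]) ->
  (forall Q B x y, p Q -> B \in Q -> x \in B -> y \in B -> r x y) ->
  is_coarsest p (coarsest p).
Proof.
move=> er pE pp pr; apply: coarsestP.
exists (equivalence_partition r [set: 'I_n]); rewrite /is_coarsest pE /=.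
apply/forallP=> Q; apply/implyP=> pQ; apply/forall_inP=> B BQ.
have /and3P[_ _ Q0] := pp _ pQ.
have /set0Pn[x xB] : B != set0 by apply: contraNneq Q0 => <-.
apply/exists_inP; exists [set y in [set: 'I_n] | r x y].
  by apply/imsetP; exists x.
by apply/subsetP=> y yB; rewrite !inE; apply: (pr Q B).
Qed.

Lemma hatP (n : nat) (P : {set {set 'I_n}}) :
  partition P [set: 'I_n] -> is_coarsest (interval_refinement P) (hat P).
Proof.
move=> pP; have /and3P[/eqP cP tP P0] := pP.
have inc x : x \in cover P by rewrite cP inE.
pose r (x y : 'I_n) := [forall z : 'I_n,
  ((x <= z <= y) || (y <= z <= x)) ==> (pblock P z == pblock P x)].
have rP (x y : 'I_n) : reflect (forall z : 'I_n, (x <= z <= y) || (y <= z <= x) ->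
    pblock P z = pblock P x) (r x y).
  by apply: (iffP forallP) => h z; [move/(implyP (h z))/eqP
    | apply/implyP=> hz; apply/eqP; exact: h].
have r_sym x y : r x y -> r y x.
  move/rP=> h; apply/rP=> z hz; rewrite (h z) 1?orbC //.
  by rewrite (h y) // leqnn andbT leq_total.
have r_trans x y z : r x y -> r y z -> r x z.
  move=> /rP h1 /rP h2; apply/rP=> w hw.
  have e : pblock P y = pblock P x by apply: h1; rewrite leqnn andbT leq_total.
  have [h|h] := boolP ((x <= w <= y) || (y <= w <= x)); first exact: h1.
  rewrite -e; apply: h2; move: hw h.
  by case: (leqP x w); case: (leqP w z); case: (leqP y w); case: (leqP w y);
    case: (leqP z w); case: (leqP w x) => //= *; exfalso;
    do ?[match goal with H : is_true (?a < ?b), K : is_true (?b <= ?a) |- _ =>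
      by move: H; rewrite ltnNge K | H : is_true (?a < ?b), K : is_true (?b < ?a) |- _ =>
      by move: H; rewrite ltnNge (ltnW K) end].
have er : equivalence_rel r.
  move=> x y z; split=> [|rxy].
    by apply/rP=> w; rewrite orbb -eqn_leq => /eqP/val_inj->.
  by apply/idP/idP; [apply: r_trans; exact: r_sym | exact: r_trans].
apply: (coarsest_of_equiv er) => [|Q /and3P[] //|Q B x y].
  apply/and3P; split.
  - by apply: equivalence_partitionP=> x y z _ _ _; exact: er.
  - apply/forall_inP=> _ /imsetP[x _ ->].
    apply/forall_inP=> a; rewrite !inE => ra.
    apply/forall_inP=> b; rewrite !inE => rb.
    apply/forallP=> z; apply/implyP=> hz; rewrite !inE.
    apply: (r_trans _ _ _ ra).
    have /rP rab : r a b by apply: (r_trans _ _ _ _ rb); exact: r_sym.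
    case/andP: hz => az zb; apply/rP=> w hw; apply: rab.
    case/orP: hw => /andP[h1 h2]; first by rewrite h1 (leq_trans h2 zb).
    by rewrite (leq_trans az h1) (leq_trans h2 (leq_trans az zb)).
  - apply/forall_inP=> _ /imsetP[x _ ->]; apply/exists_inP.
    exists (pblock P x); first exact: pblock_mem.
    apply/subsetP=> y; rewrite !inE => /rP/(_ y) <-.
      by rewrite mem_pblock.
    by rewrite leqnn andbT leq_total.
case/and3P=> pQ /forall_inP iQ /forall_inP rQ BQ xB yB.
have /exists_inP[C CP /subsetP BC] := rQ _ BQ.
have iB (a b z : 'I_n) : a \in B -> b \in B -> a <= z <= b -> z \in B.
  move=> aB bB hz; have /forall_inP/(_ _ aB)/forall_inP/(_ _ bB) := iQ _ BQ.
  by move/forallP/(_ z)/implyP; apply.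
apply/rP=> z hz; have zB : z \in B by case/orP: hz; exact: iB.
by rewrite (def_pblock tP CP (BC _ zB)) (def_pblock tP CP (BC _ xB)).
Qed.

Lemma common_refinementP (n : nat) (P Q : {set {set 'I_n}}) :
  partition P [set: 'I_n] -> partition Q [set: 'I_n] ->
  is_coarsest (is_common_refinement P Q) (common_refinement P Q).
Proof.
move=> /and3P[/eqP cP tP P0] /and3P[/eqP cQ tQ Q0].
have incP x : x \in cover P by rewrite cP inE.
have incQ x : x \in cover Q by rewrite cQ inE.
pose r (x y : 'I_n) := (pblock P x == pblock P y) && (pblock Q x == pblock Q y).
have er : equivalence_rel r.
  move=> x y z; split; first by rewrite /r !eqxx.
  by case/andP=> /eqP e1 /eqP e2; rewrite /r e1 e2.
apply: (coarsest_of_equiv er) => [|R /and3P[] //|R B x y].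
  apply/and3P; split.
  - by apply: equivalence_partitionP=> x y z _ _ _; exact: er.
  - apply/forall_inP=> _ /imsetP[x _ ->]; apply/exists_inP.
    exists (pblock P x); first exact: pblock_mem.
    by apply/subsetP=> y; rewrite !inE /= => /andP[/eqP-> _]; rewrite mem_pblock.
  - apply/forall_inP=> _ /imsetP[x _ ->]; apply/exists_inP.
    exists (pblock Q x); first exact: pblock_mem.
    by apply/subsetP=> y; rewrite !inE /= => /andP[_ /eqP->]; rewrite mem_pblock.
case/and3P=> _ /forall_inP rP /forall_inP rQ BR xB yB.
have /exists_inP[C CP /subsetP BC] := rP _ BR.
have /exists_inP[D DQ /subsetP BD] := rQ _ BR.
rewrite /r (def_pblock tP CP (BC _ xB)) (def_pblock tP CP (BC _ yB)).
by rewrite (def_pblock tQ DQ (BD _ xB)) (def_pblock tQ DQ (BD _ yB)) !eqxx.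
Qed.

(* Main.v *)
(* Colour each point of [n] by its block in P. Membership of s in Comp (r + n)
   is a condition on each point (i, s i) of the graph of s separately: whatever
   n points, (i, s i) among them, are kept, the horizontal and vertical ranks of
   (i, s i) have the same colour. This only involves the sizes of the four
   quadrants around the point. The r-th iterate of the partition identifies
   x < y exactly when the colour is constant on the window [x - r, y].

   If the colour changes between t and t + 1, a point with t < i <= t + r admits
   both t and t + 1 as ranks; trading a kept point of one quadrant for a point of
   the adjacent one then shows that two opposite quadrants around (i, s i) are
   empty. Hence i is fixed and separates what precedes it from what follows
   ("straight"), or does so in the reversed order ("skew"), and the two kinds
   cannot coexist. In the first case s preserves the iterated partition; in the
   second so does s * delta, and the colouring is symmetric. *)
Require Import Defs.
From HB Require Import structures.
From mathcomp Require Import all_boot all_fingroup.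
From mathcomp Require Import zify.

Set Implicit Arguments.
Unset Strict Implicit.
Unset Printing Implicit Defensive.

(** * Colourings and the blocks of a partition *)

(* The value at t >= n is the junk value set0. *)
Definition colour (n : nat) (P : {set {set 'I_n}}) (t : nat) : {set 'I_n} :=
  oapp (pblock P) set0 (insub t).

Lemma colour_ord (n : nat) (P : {set {set 'I_n}}) (x : 'I_n) :
  colour P x = pblock P x.
Proof. by rewrite /colour valK. Qed.

Lemma colour_path (n : nat) (P : {set {set 'I_n}}) (a b : nat) :
  a <= b -> (forall t, a <= t < b -> colour P t = colour P t.+1) ->
  colour P a = colour P b.
Proof.
elim: b => [|b IHb]; first by rewrite leqn0 => /eqP->.
rewrite leq_eqVlt => /orP[/eqP-> //|ab] h.
rewrite IHb //; first by apply: h; lia.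
by move=> t ht; apply: h; lia.
Qed.

Lemma partition_blockE (n : nat) (P : {set {set 'I_n}}) (B : {set 'I_n}) (x y : 'I_n) :
  partition P [set: 'I_n] -> B \in P -> x \in B ->
  (y \in B) = (pblock P y == pblock P x).
Proof.
move=> /and3P[/eqP cP tP _] BP xB; rewrite (def_pblock tP BP xB).
by apply/idP/eqP => [/(def_pblock tP BP)|<-]; rewrite ?mem_pblock ?cP ?inE.
Qed.

Lemma stab_partP (n : nat) (P : {set {set 'I_n}}) (s : {perm 'I_n}) :
  partition P [set: 'I_n] ->
  reflect (forall x, pblock P (s x) = pblock P x) (s \in stab_part P).
Proof.
move=> pP; have /and3P[/eqP cP tP _] := pP.
rewrite inE; apply: (iffP forall_inP) => [h x|h B BP].
  have xP : x \in cover P by rewrite cP inE.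
  have /eqP e := h _ (pblock_mem xP).
  apply: def_pblock => //; first exact: pblock_mem.
  by rewrite -e imset_f // mem_pblock.
rewrite eqEcard card_imset ?leqnn ?andbT; last exact: perm_inj.
apply/subsetP=> _ /imsetP[x xB ->].
by rewrite (partition_blockE _ pP BP xB) h.
Qed.

Lemma refines_pblock (n : nat) (P Q : {set {set 'I_n}}) (x y : 'I_n) :
  partition P [set: 'I_n] -> partition Q [set: 'I_n] -> refines Q P ->
  pblock Q x = pblock Q y -> pblock P x = pblock P y.
Proof.
move=> /and3P[_ tP _] /and3P[/eqP cQ _ _] /forall_inP rQP e.
have inQ z : z \in cover Q by rewrite cQ inE.
have /exists_inP[C CP /subsetP QC] := rQP _ (pblock_mem (inQ x)).
rewrite (def_pblock tP CP (QC _ _)) ?mem_pblock //.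
by rewrite (def_pblock tP CP (QC _ _)) // e mem_pblock.
Qed.

Lemma preim_pblock (n : nat) (rT : eqType) (f : 'I_n -> rT) (x y : 'I_n) :
  (pblock (preim_partition f [set: 'I_n]) x == pblock (preim_partition f [set: 'I_n]) y)
  = (f x == f y).
Proof.
have pE := preim_partitionP f [set: 'I_n]; have /and3P[/eqP cE tE _] := pE.
rewrite eq_pblock ?cE ?inE // pblock_equivalence_partition ?inE //.
by move=> u v w _ _ _; split=> [|/eqP->].
Qed.

Lemma preim_refines (n : nat) (rT : eqType) (f : 'I_n -> rT) (P : {set {set 'I_n}}) :
  partition P [set: 'I_n] ->
  (forall x y, f x = f y -> pblock P x = pblock P y) ->
  refines (preim_partition f [set: 'I_n]) P.
Proof.
move=> /and3P[/eqP cP tP _] h; have inP x : x \in cover P by rewrite cP inE.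
apply/forall_inP=> _ /imsetP[x _ ->]; apply/exists_inP.
exists (pblock P x); first exact: pblock_mem.
by apply/subsetP=> y; rewrite !inE /= => /eqP/h->; rewrite mem_pblock.
Qed.

(** * Blocks of the interval refinement *)

Lemma hat_partition (n : nat) (P : {set {set 'I_n}}) :
  partition P [set: 'I_n] -> partition (hat P) [set: 'I_n].
Proof. by move=> /hatP/andP[/and3P[]]. Qed.

(** Blocks of [hat P] are intervals inside blocks of [P], which gives one direction. For the other,
    coarseness is tested against an interval refinement of [P] that has [x, y] as a block. *)
Lemma hat_pblockP (n : nat) (P : {set {set 'I_n}}) (x y : 'I_n) :
  partition P [set: 'I_n] -> x <= y ->
  reflect (forall t, x <= t < y -> colour P t = colour P t.+1)
    (pblock (hat P) x == pblock (hat P) y).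
Proof.
move=> pP xy; have /andP[/and3P[pH /forall_inP iH rH] /forallP mH] := hatP pP.
have /and3P[/eqP cH tH _] := pH; have inH z : z \in cover (hat P) by rewrite cH inE.
apply: (iffP eqP) => [e t /andP[xt ty]|h].
  have mid (z : 'I_n) : x <= z <= y -> pblock P z = pblock P x.
    move=> hz; apply: (refines_pblock pP pH rH); apply: def_pblock => //.
      exact: pblock_mem.
    have /forall_inP/(_ x) := iH _ (pblock_mem (inH x)).
    rewrite mem_pblock => /(_ (inH x))/forall_inP/(_ y).
    by rewrite {1}e mem_pblock => /(_ (inH y))/forallP/(_ z); rewrite hz.
  have tn : t.+1 < n by apply: leq_ltn_trans ty (ltn_ord y).
  have := colour_ord P (Ordinal tn); have := colour_ord P (Ordinal (ltnW tn)).
  by move=> /= -> ->; rewrite !mid //=; lia.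
(* The fibres of [f] are [x, y] and the singletons outside it. *)
pose f (z : 'I_n) := if x <= z <= y then x else z.
have cst (z : 'I_n) : x <= z <= y -> pblock P z = pblock P x.
  move=> /andP[xz zy]; rewrite -!colour_ord; symmetry; apply: colour_path => // t ht.
  by apply: h; lia.
suff /(refines_pblock pH (preim_partitionP f _)) : refines (preim_partition f setT) (hat P).
  apply; apply/eqP; rewrite preim_pblock /f.
  by rewrite leqnn xy leqnn.
apply: (implyP (mH _)); apply/and3P; split; first exact: preim_partitionP.
  apply/forall_inP=> _ /imsetP[u _ ->].
  apply/forall_inP=> a; rewrite !inE /= => /eqP fa.
  apply/forall_inP=> b; rewrite !inE /= => /eqP fb.
  apply/forallP=> z; apply/implyP=> hz; rewrite !inE /=; apply/eqP.
  move: fa fb; rewrite /f.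
  by do 4?case: ifP => ?; move=> *; subst; apply/val_inj => /=; lia.
apply: preim_refines => // u v; rewrite /f.
by do 2!case: ifP => [/cst ?|_] ; move=> *; subst; congruence.
Qed.

(** * The prime operation as a pair of pullbacks *)

Lemma preimset_partition (T T' : finType) (g : T -> T') (P : {set {set T'}}) :
  (forall y, exists x, g x = y) -> partition P [set: T'] ->
  partition [set g @^-1: B | B : {set T'} in P] [set: T].
Proof.
move=> gsurj /and3P[/eqP cP tP P0]; apply/and3P; split.
- rewrite eqEsubset subsetT /=; apply/subsetP=> x _; apply/bigcupP.
  have xP : g x \in cover P by rewrite cP inE.
  exists (g @^-1: pblock P (g x)); last by rewrite inE mem_pblock.
  by apply: imset_f; exact: pblock_mem.
- apply/trivIsetP=> _ _ /imsetP[B BP ->] /imsetP[C CP ->] BC.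
  have {}BC : B != C by apply: contraNneq BC => ->.
  have := trivIsetP tP _ _ BP CP BC; rewrite -!setI_eq0 => /eqP e.
  by rewrite -preimsetI e preimset0.
- apply/imsetP=> -[B BP e]; case: (set_0Vmem B) => [B0|[y yB]].
    by move: P0; rewrite -B0 BP.
  by have [x gx] := gsurj y; have := in_set0 x; rewrite e inE gx yB.
Qed.

Lemma preimset_pblock (n m : nat) (g : 'I_m -> 'I_n) (P : {set {set 'I_n}}) (x y : 'I_m) :
  (forall y, exists x, g x = y) -> partition P [set: 'I_n] ->
  (pblock [set g @^-1: B | B : {set 'I_n} in P] x ==
   pblock [set g @^-1: B | B : {set 'I_n} in P] y) =
  (pblock P (g x) == pblock P (g y)).
Proof.
move=> gs pP; have pQ := preimset_partition gs pP; have /and3P[/eqP cP tP _] := pP.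
have gP : g y \in cover P by rewrite cP inE.
have BP := pblock_mem gP.
rewrite -(@partition_blockE _ _ (g @^-1: pblock P (g y)) y x pQ) ?imset_f ?inE ?mem_pblock //.
by rewrite (@partition_blockE _ _ _ (g y) (g x) pP BP) // mem_pblock.
Qed.

(** [dec_ord] and [clip_ord] are left inverses of [lift ord0] and [lift ord_max], merging the new
    end point with its neighbour. Pulling [hat P] back along them therefore adjoins the new point to
    the first or last block, with no case distinction on blocks. *)
Definition dec_ord (n : nat) (x : 'I_n.+2) : 'I_n.+1 := inord x.-1.
Definition clip_ord (n : nat) (x : 'I_n.+2) : 'I_n.+1 := inord (minn x n).

Lemma dec_ordE (n : nat) (x : 'I_n.+2) : dec_ord x = x.-1 :> nat.
Proof. by rewrite /dec_ord inordK //; have := ltn_ord x; lia. Qed.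

Lemma clip_ordE (n : nat) (x : 'I_n.+2) : clip_ord x = minn x n :> nat.
Proof. by rewrite /clip_ord inordK //; have := ltn_ord x; lia. Qed.

Lemma dec_ord_surj (n : nat) (y : 'I_n.+1) : exists x, dec_ord x = y.
Proof.
by exists (lift ord0 y); apply: val_inj; rewrite /= dec_ordE lift0.
Qed.

Lemma clip_ord_surj (n : nat) (y : 'I_n.+1) : exists x, clip_ord x = y.
Proof.
exists (lift ord_max y); apply: val_inj; rewrite /= clip_ordE lift_max.
by have := ltn_ord y; lia.
Qed.

Lemma imset_cases (aT rT : finType) (D : {set aT}) (p : pred aT) (f g h : aT -> rT) :
  (forall x, ~~ p x -> f x = h x) -> (forall x, p x -> g x = h x) ->
  [set f x | x in D & ~~ p x] :|: [set g x | x in D & p x] = [set h x | x in D].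
Proof.
move=> fh gh; apply/setP=> z; rewrite inE; apply/orP/imsetP.
  by case=> /imsetP[x]; rewrite inE => /andP[xD px] ->; exists x; rewrite ?fh ?gh.
case=> x xD ->; case: (boolP (p x)) => px; [right|left]; apply/imsetP; exists x;
  by rewrite ?inE ?xD ?px ?fh ?gh.
Qed.

Lemma hat_firstE (n : nat) (P : {set {set 'I_n.+1}}) :
  hat_first P = [set (@dec_ord n) @^-1: B | B : {set 'I_n.+1} in hat P].
Proof.
have decK (x : 'I_n.+1) : dec_ord (lift ord0 x) = x.
  by apply: val_inj; rewrite /= dec_ordE lift0.
have dec0 : dec_ord ord0 = ord0 :> 'I_n.+1 by apply: val_inj; rewrite /= dec_ordE.
have firstE (B : {set 'I_n.+1}) : has_first B = (ord0 \in B).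
  apply/exists_inP/idP => [[x xB /eqP x0]|h]; last by exists ord0.
  by rewrite (_ : ord0 = x) //; apply: val_inj.
apply: imset_cases => B; rewrite firstE => B0; apply/setP=> x; rewrite !inE;
  case: (unliftP ord0 x) => [y|] ->.
- by rewrite decK (mem_imset _ _ (@lift_inj _ _)).
- rewrite dec0 (negPf B0); apply/imsetP=> -[y _ e].
  by have := neq_lift ord0 y; rewrite -e eqxx.
- by rewrite decK (mem_imset _ _ (@lift_inj _ _)) eq_sym (negPf (neq_lift _ _)) orbF.
- by rewrite dec0 B0 eqxx orbT.
Qed.

Lemma hat_lastE (n : nat) (P : {set {set 'I_n.+1}}) :
  hat_last P = [set (@clip_ord n) @^-1: B | B : {set 'I_n.+1} in hat P].
Proof.
have clipK (x : 'I_n.+1) : clip_ord (lift ord_max x) = x.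
  by apply: val_inj; rewrite /= clip_ordE lift_max; have := ltn_ord x; lia.
have clip0 : clip_ord ord_max = ord_max :> 'I_n.+1.
  by apply: val_inj; rewrite /= clip_ordE /=; lia.
have lastE (B : {set 'I_n.+1}) : has_last B = (ord_max \in B).
  apply/exists_inP/idP => [[x xB /eqP x0]|h]; last by exists ord_max.
  by rewrite (_ : ord_max = x) //; apply: val_inj => /=; lia.
apply: imset_cases => B; rewrite lastE => B0; apply/setP=> x; rewrite !inE;
  case: (unliftP ord_max x) => [y|] ->.
- by rewrite clipK (mem_imset _ _ (@lift_inj _ _)).
- rewrite clip0 (negPf B0); apply/imsetP=> -[y _ e].
  by have := neq_lift ord_max y; rewrite -e eqxx.
- by rewrite clipK (mem_imset _ _ (@lift_inj _ _)) eq_sym (negPf (neq_lift _ _)) orbF.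
- by rewrite clip0 B0 eqxx orbT.
Qed.

Lemma common_refinement_pblock (n : nat) (P Q : {set {set 'I_n}}) (x y : 'I_n) :
  partition P [set: 'I_n] -> partition Q [set: 'I_n] ->
  (pblock (common_refinement P Q) x == pblock (common_refinement P Q) y) =
  (pblock P x == pblock P y) && (pblock Q x == pblock Q y).
Proof.
move=> pP pQ.
have /andP[/and3P[pR rP rQ] /forallP mR] := common_refinementP pP pQ.
apply/eqP/andP => [e|[/eqP eP /eqP eQ]].
  by split; apply/eqP; [apply: (refines_pblock pP pR rP) | apply: (refines_pblock pQ pR rQ)].
pose f (z : 'I_n) := (pblock P z, pblock Q z).
suff /(refines_pblock pR (preim_partitionP f _)) :
    refines (preim_partition f setT) (common_refinement P Q).
  by apply; apply/eqP; rewrite preim_pblock /f eP eQ.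
apply: (implyP (mR _)); apply/and3P; split; first exact: preim_partitionP.
  by apply: preim_refines => // u v [].
by apply: preim_refines => // u v [].
Qed.

Lemma prime_part_partition (n : nat) (P : {set {set 'I_n}}) :
  0 < n -> partition P [set: 'I_n] -> partition (prime_part P) [set: 'I_n.+1].
Proof.
case: n P => // n P _ /hat_partition pH.
have pF := preimset_partition (@dec_ord_surj n) pH.
have pL := preimset_partition (@clip_ord_surj n) pH.
rewrite /prime_part hat_firstE hat_lastE.
by have /andP[/and3P[]] := common_refinementP pF pL.
Qed.

(** The pullback along [dec_ord] controls the steps from t to t + 1 with x - 1 <= t < y - 1, the one
    along [clip_ord] those with x <= t < y. Since x < y, together they cover x - 1 <= t <= y - 1. *)
Lemma prime_part_pblockP (n : nat) (P : {set {set 'I_n}}) (x y : 'I_n.+1) :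
  0 < n -> partition P [set: 'I_n] -> x < y ->
  reflect (forall t, t.+1 < n -> x <= t.+1 <= y -> colour P t = colour P t.+1)
    (pblock (prime_part P) x == pblock (prime_part P) y).
Proof.
case: n P x y => // n P x y _ pP xy; have pH := hat_partition pP.
have ny := ltn_ord y.
have pF := preimset_partition (@dec_ord_surj n) pH.
have pL := preimset_partition (@clip_ord_surj n) pH.
rewrite /prime_part hat_firstE hat_lastE common_refinement_pblock //.
rewrite !preimset_pblock //; try exact: dec_ord_surj; try exact: clip_ord_surj.
have xyd : dec_ord x <= dec_ord y by rewrite !dec_ordE; lia.
have xyc : clip_ord x <= clip_ord y by rewrite !clip_ordE; lia.
apply: (iffP andP) => [[/hat_pblockP h1 /hat_pblockP h2] t tn ht|h].
  have {}h1 := h1 pP xyd t; have {}h2 := h2 pP xyc t.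
  rewrite !dec_ordE in h1; rewrite !clip_ordE in h2.
  by case: (ltnP t y.-1) => ?; [apply: h1 | apply: h2]; lia.
by split; apply/hat_pblockP => // t; rewrite ?dec_ordE ?clip_ordE => ?; apply: h; lia.
Qed.

(** * Iterates of the prime operation *)

Lemma iter_part_partition (n : nat) (P : {set {set 'I_n}}) (r : nat) :
  0 < n -> partition P [set: 'I_n] -> partition (iter_part P r) [set: 'I_(r + n)].
Proof.
move=> n0 pP; elim: r => [//|r IHr]; apply: (@prime_part_partition (r + n)) => //; lia.
Qed.

(** Say that a change between u and u + 1 has place u. One prime step spreads it to the places u and
    u + 1, so r steps spread it to the places u, ..., u + r. *)
Lemma colour_iter_partP (n : nat) (P : {set {set 'I_n}}) (r t : nat) :
  0 < n -> partition P [set: 'I_n] -> t.+1 < r + n ->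
  (colour (iter_part P r) t = colour (iter_part P r) t.+1) <->
  (forall u, u.+1 < n -> u <= t <= u + r -> colour P u = colour P u.+1).
Proof.
move=> n0 pP; elim: r t => [|r IHr] t tn.
  split=> [/= e u un tu|h]; last by apply: h; lia.
  by rewrite (_ : u = t) //; lia.
have pQ := iter_part_partition r n0 pP.
have t1 : t.+1 < (r + n).+1 by lia.
have rn : 0 < r + n by lia.
have t2 := ltnW t1.
have h := @prime_part_pblockP _ _ (Ordinal t2) (Ordinal t1) rn pQ (ltnSn t).
rewrite -(colour_ord _ (Ordinal t2)) -(colour_ord _ (Ordinal t1)) /= in h.
split=> [/eqP/h{}h u un ut|g].
  (* The place among t - 1 and t that is nearest to u, so that u <= v <= u + r. *)
  pose v := minn (maxn u t.-1) t.
  have vn : v.+1 < r + n by lia.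
  have hv : t <= v.+1 <= t.+1 by lia.
  by have /(IHr _ vn) := h v vn hv; apply=> //; lia.
apply/eqP/h => v vn hv; apply/(IHr _ vn) => u un uv.
by apply: g; lia.
Qed.

(** Blocks of [P] itself need not be intervals. The last prime step is peeled off because only after
    it do the steps between neighbours decide whether distant points share a block. *)
Lemma iter_part_pblockP (n : nat) (P : {set {set 'I_n}}) (r : nat) (x y : 'I_(r + n)) :
  0 < n -> 0 < r -> partition P [set: 'I_n] -> x < y ->
  (pblock (iter_part P r) x = pblock (iter_part P r) y) <->
  (forall t, t.+1 < n -> x <= t + r -> t < y -> colour P t = colour P t.+1).
Proof.
case: r x y => // r x y n0 _ pP xy; have pQ := iter_part_partition r n0 pP.
have rn : 0 < r + n by lia.
have yn : y < r.+1 + n := ltn_ord y.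
have h := prime_part_pblockP rn pQ xy.
split=> [/eqP/h{}h t tn xt ty|g].
  pose v := maxn t x.-1.
  have vn : v.+1 < r + n by lia.
  have hv : x <= v.+1 <= y by lia.
  by have /(colour_iter_partP n0 pP vn) := h v vn hv; apply=> //; lia.
apply/eqP/h => v vn hv; apply/(colour_iter_partP n0 pP vn) => u un uv.
have {}hv : x <= v.+1 <= y := hv.
by apply: g; lia.
Qed.

(** * Ranks within a set of kept points *)

Lemma card_ord_lt (n : nat) (i : 'I_n) : #|[set k : 'I_n | k < i]| = i.
Proof.
by rewrite -sum1dep_card (big_ord_narrow (ltnW (ltn_ord i))) sum1_card card_ord.
Qed.

Lemma card_perm_lt (n : nat) (s : {perm 'I_n}) (i : 'I_n) :
  #|[set k | s k < s i]| = s i.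
Proof.
rewrite -[RHS]card_ord_lt -(card_imset _ (@perm_inj _ s)); apply: eq_card => k.
rewrite inE; apply/imsetP/idP => [[j + ->]|h]; first by rewrite inE.
by exists (s^-1 k)%g; rewrite ?inE permKV.
Qed.

Lemma exists_subset_card (T : finType) (A : {set T}) (a : nat) :
  a <= #|A| -> exists2 B : {set T}, B \subset A & #|B| = a.
Proof.
elim: a => [|a IHa] aA; first by exists set0; rewrite ?sub0set ?cards0.
have [B BA Ba] := IHa (ltnW aA).
have /subsetPn[x xA xB] : ~~ (A \subset B).
  by apply: contraL aA => /subset_leq_card; rewrite Ba -leqNgt.
by exists (x |: B); rewrite ?cardsU1 ?xB ?Ba // subUset sub1set xA.
Qed.

(** For [h] equal to [val] or [val \o s], this is the horizontal or vertical coordinate, counted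
    from 0, of (i, s i) in the pattern of [s] on [K]. *)
Definition rank (T : finType) (h : T -> nat) (K : {set T}) (i : T) : nat := #|[set k in K | h k < h i]|.

Lemma rank_lt (T : finType) (h : T -> nat) (K : {set T}) (i j : T) :
  i \in K -> (rank h K i < rank h K j) = (h i < h j).
Proof.
move=> iK; apply/idP/idP => [|ij].
  apply: contraLR; rewrite -!leqNgt => ji; apply/subset_leq_card/subsetP => k.
  by rewrite !inE => /andP[-> /leq_trans->].
apply/proper_card/properP; split; last by exists i; rewrite !inE iK ?ltnn ?ij.
by apply/subsetP=> k; rewrite !inE => /andP[-> /ltn_trans->].
Qed.

Lemma rank_inj (T : finType) (h : T -> nat) (K : {set T}) :
  injective h -> {in K &, injective (rank h K)}.
Proof.
move=> h_inj i j iK jK e; apply: h_inj; have := rank_lt h j iK; have := rank_lt h i jK.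
by rewrite e ltnn; case: ltngtP.
Qed.

Lemma rank_bound (T : finType) (h : T -> nat) (K : {set T}) (i : T) :
  i \in K -> rank h K i < #|K|.
Proof.
move=> iK; apply/proper_card/properP; split; last by exists i; rewrite ?inE ?ltnn ?andbF.
by apply/subsetP=> k; rewrite !inE => /andP[].
Qed.

Lemma rank_surj (T : finType) (h : T -> nat) (K : {set T}) (j : nat) :
  injective h -> j < #|K| -> exists i, i \in K /\ rank h K i = j.
Proof.
move=> h_inj; case Kp : #|K| => [//|p] jp; pose g i : 'I_p.+1 := inord (rank h K i).
have gE i : i \in K -> g i = rank h K i :> nat.
  by move=> iK; rewrite inordK // -Kp rank_bound.
have g_inj : {in K &, injective g}.
  by move=> i k iK kK e; apply: (rank_inj h_inj iK kK); rewrite -(gE i) // -(gE k) // e.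
have /setP/(_ (Ordinal jp)) : g @: K = setT.
  by apply/eqP; rewrite eqEcard subsetT cardsT card_ord (card_in_imset g_inj) Kp leqnn.
by rewrite inE => /imsetP[i iK e]; exists i; split=> //; rewrite -gE // -e.
Qed.

Lemma rank_imset (T U : finType) (f : T -> U) (h : U -> nat) (K : {set T}) (i : T) :
  injective f -> rank h (f @: K) (f i) = rank (h \o f) K i.
Proof.
move=> f_inj; rewrite /rank -[RHS](card_imset _ f_inj); apply: eq_card => k; rewrite inE.
apply/andP/imsetP => [[/imsetP[l lK ->]] /= h1|[l + ->]].
  by exists l; rewrite // inE lK.
by rewrite inE /= => /andP[lK ->]; rewrite imset_f.
Qed.

(** * Patterns in terms of ranks *)

Definition pattern_stable (n m : nat) (P : {set {set 'I_n}}) (s : {perm 'I_m}) : Prop :=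
  forall (K : {set 'I_m}) (i : 'I_m), #|K| = n -> i \in K ->
    colour P (rank val K i) = colour P (rank (val \o s) K i).

Lemma CompP (n m : nat) (P : {set {set 'I_n}}) (s : {perm 'I_m}) :
  partition P [set: 'I_n] ->
  s \in Comp m (stab_part P) <-> pattern_stable P s.
Proof.
move=> pP; have s_inj : injective (val \o s) by move=> x y /val_inj/perm_inj.
rewrite inE; split=> [/forallP h K i Kn iK|h].
  (* [f] is the increasing enumeration of [K]. *)
  have [f fP] : exists f : 'I_n -> 'I_m, forall j, f j \in K /\ rank val K (f j) = j.
    have/fin_all_exists// : forall j : 'I_n, exists i, i \in K /\ rank val K i = j.
    by move=> j; apply: (rank_surj (@val_inj _ _ _)); rewrite Kn.
  have fK j : f j \in K by case: (fP j).
  have fr j : rank val K (f j) = j by case: (fP j).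
  have tlt j : rank (val \o s) K (f j) < n by rewrite -Kn rank_bound.
  (* The pattern of [s] on [K] sends j to the vertical rank of [f j]. *)
  have t_inj : injective (fun j => Ordinal (tlt j)).
    move=> j k /(congr1 val) /= /(rank_inj s_inj (fK j) (fK k)) e.
    by apply: val_inj; rewrite /= -(fr j) e fr.
  have /stab_partP-/(_ pP) tP : perm t_inj \in stab_part P.
    apply: (implyP (h _)); apply/existsP; exists (finfun f); apply/andP; split.
      apply/forallP=> j; apply/forallP=> k; apply/implyP; rewrite !ffunE => jk.
      by rewrite -(rank_lt val _ (fK j)) !fr.
    apply/forallP=> j; apply/forallP=> k; rewrite !ffunE !permE /=.
    by rewrite (rank_lt _ _ (fK j)).
  have ir : rank val K i < n by rewrite -Kn rank_bound.
  have ei : i = f (Ordinal ir) by apply: (rank_inj (@val_inj _ _ _) iK (fK _)); rewrite fr.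
  have := tP (Ordinal ir); rewrite -!colour_ord permE /= -ei.
  by move=> ->.
apply/forallP=> t; apply/implyP=> /existsP[f /andP[/forallP fm /forallP ft]].
have {}fm (j k : 'I_n) : j < k -> f j < f k by move: (fm j) => /forallP/(_ k)/implyP; apply.
have {}ft (j k : 'I_n) : (s (f j) < s (f k)) = (t j < t k).
  by move: (ft j) => /forallP/(_ k)/eqP.
have fE (j k : 'I_n) : (f j < f k) = (j < k).
  by case: (ltngtP j k) => [/fm //|/fm|/val_inj->]; rewrite ?ltnn //; lia.
have f_inj : injective f.
  by move=> j k e; apply: val_inj => /=; have := fE j k; have := fE k j; rewrite e ltnn; lia.
apply/(stab_partP _ pP) => j; rewrite -!colour_ord.
(* Conversely, in the image of an embedding [f] of [t], the two ranks of [f j] are j and [t j]. *)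
have Kn : #|f @: setT| = n by rewrite card_imset // cardsT card_ord.
have := h _ (f j) Kn (imset_f f (in_setT j)).
rewrite !rank_imset //.
have -> : rank (val \o f) setT j = j.
  by rewrite -[RHS]card_ord_lt; apply: eq_card => k; rewrite !inE /= fE.
have -> // : rank ((val \o s) \o f) setT j = t j.
by rewrite -card_perm_lt; apply: eq_card => k; rewrite !inE /= ft.
Qed.

(** The vertical rank of i for [s] in [K] is the horizontal rank of [s i] in [s @: K], so the
    condition for [t] at [s @: K] continues the one for [s] at [K]. *)
Lemma pattern_stableM (n m : nat) (P : {set {set 'I_n}}) (s t : {perm 'I_m}) :
  pattern_stable P s -> pattern_stable P t -> pattern_stable P (s * t)%g.
Proof.
move=> hs ht K i Kn iK; have s_inj := @perm_inj _ s.
have -> : rank (val \o (s * t)%g) K i = rank ((val \o t) \o s) K i.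
  by apply: eq_card => k; rewrite !inE /= !permM.
by rewrite hs // -(rank_imset val K i s_inj) -(rank_imset (val \o t) K i s_inj) ht ?imset_f // card_imset.
Qed.

(** * Quadrants around a point of the graph *)

(* The points of the graph of s lying in each quadrant around (i, s i). *)
Definition SW (m : nat) (s : {perm 'I_m}) (i : 'I_m) := [set k : 'I_m | (k < i) && (s k < s i)].
Definition NW (m : nat) (s : {perm 'I_m}) (i : 'I_m) := [set k : 'I_m | (k < i) && (s i < s k)].
Definition SE (m : nat) (s : {perm 'I_m}) (i : 'I_m) := [set k : 'I_m | (i < k) && (s k < s i)].
Definition NE (m : nat) (s : {perm 'I_m}) (i : 'I_m) := [set k : 'I_m | (i < k) && (s i < s k)].

(** Keep i together with a, b, c, d points of the four quadrants: then a + b kept points lie to the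
    left of (i, s i) and a + c below it. *)
Lemma pattern_stable_quadrants (n m : nat) (P : {set {set 'I_n}}) (s : {perm 'I_m})
    (i : 'I_m) (a b c d : nat) :
  pattern_stable P s ->
  a <= #|SW s i| -> b <= #|NW s i| -> c <= #|SE s i| -> d <= #|NE s i| ->
  (a + b + c + d).+1 = n -> colour P (a + b) = colour P (a + c).
Proof.
move=> hs /exists_subset_card[A /subsetP sA <-] /exists_subset_card[B /subsetP sB <-].
move=> /exists_subset_card[C /subsetP sC <-] /exists_subset_card[D /subsetP sD <-] e.
have qA k : k \in A -> (k < i) && (s k < s i) by move/sA; rewrite inE.
have qB k : k \in B -> (k < i) && (s i < s k) by move/sB; rewrite inE.
have qC k : k \in C -> (i < k) && (s k < s i) by move/sC; rewrite inE.
have qD k : k \in D -> (i < k) && (s i < s k) by move/sD; rewrite inE.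
have dis (X Y : {set 'I_m}) : (forall k, k \in X -> k \in Y -> False) ->
    #|X :|: Y| = #|X| + #|Y|.
  move=> h; rewrite cardsU (_ : X :&: Y = set0) ?cards0 ?subn0 //.
  by apply/setP=> k; rewrite !inE; apply/negP=> /andP[]; exact: h.
have dAB : #|A :|: B| = #|A| + #|B| by apply: dis => k /qA ? /qB ?; lia.
have dAC : #|A :|: C| = #|A| + #|C| by apply: dis => k /qA ? /qC ?; lia.
have dCD : #|C :|: D| = #|C| + #|D| by apply: dis => k /qC ? /qD ?; lia.
pose K := i |: ((A :|: B) :|: (C :|: D)).
have iK : i \in K by rewrite !inE eqxx.
have Kn : #|K| = n.
  rewrite cardsU1 dis => [|k].
    rewrite dAB dCD; case: (boolP (i \in _)) => [|_]; last by lia.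
    by rewrite !inE => /orP[/orP[/qA|/qB]|/orP[/qC|/qD]]; lia.
  by rewrite !inE => /orP[/qA|/qB] ? /orP[/qC|/qD] ?; lia.
have := hs K i Kn iK.
have -> : rank val K i = #|A| + #|B|.
  rewrite -dAB; apply: eq_card => k; rewrite !inE.
  have := qA k; have := qB k; have := qC k; have := qD k.
  case: eqP => [->|_]; case: (k \in A); case: (k \in B); case: (k \in C); case: (k \in D);
    move=> /= *; lia.
have -> : rank (val \o s) K i = #|A| + #|C|.
  rewrite -dAC; apply: eq_card => k; rewrite !inE.
  have := qA k; have := qB k; have := qC k; have := qD k.
  case: eqP => [->|_]; case: (k \in A); case: (k \in B); case: (k \in C); case: (k \in D);
    move=> /= *; lia.
by [].
Qed.

Lemma card_lt_split (m : nat) (i : 'I_m) (p : pred 'I_m) :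
  p i = false ->
  #|[set k : 'I_m | (k < i) && p k]| + #|[set k : 'I_m | (i < k) && p k]| = #|[set k | p k]|.
Proof.
move=> pi; rewrite -(cardsID [set k : 'I_m | k < i] [set k | p k]); congr (_ + _).
  by apply: eq_card => k; rewrite !inE andbC.
apply: eq_card => k; rewrite !inE; case: ltngtP => //= /val_inj e.
by rewrite -e pi.
Qed.

Lemma card_quadrants (m : nat) (s : {perm 'I_m}) (i : 'I_m) :
  [/\ #|SW s i| + #|NW s i| = i, #|SW s i| + #|SE s i| = s i
    & (#|SE s i| + #|NE s i| + i).+1 = m].
Proof.
have e1 : #|SW s i| + #|SE s i| = s i.
  by rewrite (card_lt_split (p := fun k => s k < s i)) ?ltnn // card_perm_lt.
have e2 : #|SW s i| + #|NW s i| = i.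
  rewrite -[RHS]card_ord_lt -(cardsID [set k | s k < s i] [set k : 'I_m | k < i]).
  congr (_ + _); apply: eq_card => k; rewrite !inE // andbC.
  by case: (ltngtP (s k) (s i)) => //= /val_inj/perm_inj->; rewrite ltnn.
have e3 : #|NW s i| + #|NE s i| = #|[set k | s i < s k]|.
  by rewrite (card_lt_split (p := fun k => s i < s k)) ?ltnn.
have e4 : (s i + #|[set k | s i < s k]|).+1 = m.
  have := cardsC [set k | s k < s i]; rewrite card_perm_lt card_ord.
  rewrite (cardsD1 i) !inE ltnn /=.
  have -> : (~: [set k | s k < s i]) :\ i = [set k | s i < s k].
    apply/setP=> k; rewrite !inE; case: (ltngtP (s k) (s i)) => [h|h|/val_inj/perm_inj->].
    - by rewrite andbF.
    - by rewrite andbT; apply: contraTneq h => ->; rewrite ltnn.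
    - by rewrite eqxx.
  by rewrite add1n addnS.
by split=> //; lia.
Qed.

(** * Straight and skew points *)

Definition straight (m : nat) (s : {perm 'I_m}) (i : 'I_m) : bool :=
  [forall k : 'I_m, (k < i) == (s k < s i)].

Definition skew (m : nat) (s : {perm 'I_m}) (i : 'I_m) : bool :=
  [forall k : 'I_m, (k < i) == (s i < s k)].

Lemma straightP (m : nat) (s : {perm 'I_m}) (i : 'I_m) :
  reflect (forall k : 'I_m, (k < i) = (s k < s i)) (straight s i).
Proof. exact: 'forall_eqP. Qed.

Lemma skewP (m : nat) (s : {perm 'I_m}) (i : 'I_m) :
  reflect (forall k : 'I_m, (k < i) = (s i < s k)) (skew s i).
Proof. exact: 'forall_eqP. Qed.

Lemma straight_fixed (m : nat) (s : {perm 'I_m}) (i : 'I_m) : straight s i -> s i = i.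
Proof.
move=> /straightP h; apply: val_inj; rewrite /= -card_perm_lt -[RHS]card_ord_lt.
by apply: eq_card => k; rewrite !inE h.
Qed.

Lemma straight_quadrants (m : nat) (s : {perm 'I_m}) (i : 'I_m) :
  straight s i = (#|NW s i| == 0) && (#|SE s i| == 0).
Proof.
rewrite !cards_eq0; apply/straightP/andP => [h|[/eqP/setP hNW /eqP/setP hSE] k].
  by split; apply/eqP/setP=> k; have := h k; rewrite !inE; lia.
have := hNW k; have := hSE k; rewrite !inE.
case: (ltngtP k i) => [ki|_|/val_inj ->]; last by rewrite ltnn.
  by case: (ltngtP (s k) (s i)) => // /val_inj/perm_inj e; rewrite e ltnn in ki.
by lia.
Qed.

Lemma skew_quadrants (m : nat) (s : {perm 'I_m}) (i : 'I_m) :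
  skew s i = (#|SW s i| == 0) && (#|NE s i| == 0).
Proof.
rewrite !cards_eq0; apply/skewP/andP => [h|[/eqP/setP hSW /eqP/setP hNE] k].
  by split; apply/eqP/setP=> k; have := h k; rewrite !inE; lia.
have := hSW k; have := hNE k; rewrite !inE.
case: (ltngtP k i) => [ki|_|/val_inj ->]; last by rewrite ltnn.
  by case: (ltngtP (s k) (s i)) => // /val_inj/perm_inj e; rewrite e ltnn in ki.
by lia.
Qed.

(** Otherwise the pair i, j would be both an inversion and a non-inversion of [s]. *)
Lemma straight_not_skew (m : nat) (s : {perm 'I_m}) (i j : 'I_m) :
  i != j -> straight s i -> ~~ skew s j.
Proof.
move=> ij /straightP hi; apply/negP=> /skewP hj.
have := hi j; have := hj i; move: ij; rewrite -val_eqE /=; lia.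
Qed.

(* [t] is a boundary between two blocks of the interval refinement of [P]. *)
Definition cut (n : nat) (P : {set {set 'I_n}}) (t : nat) : bool :=
  (t.+1 < n) && (colour P t != colour P t.+1).

Lemma straight_or_skew (n r : nat) (P : {set {set 'I_n}}) (s : {perm 'I_(r + n)})
    (t : nat) (i : 'I_(r + n)) :
  pattern_stable P s -> cut P t -> t < i <= t + r -> straight s i || skew s i.
Proof.
move=> hs /andP[tn /eqP ct] ti.
have [e1 e2 e3] := card_quadrants s i.
have Q a b c d := @pattern_stable_quadrants _ _ _ _ i a b c d hs.
rewrite straight_quadrants skew_quadrants.
move: (#|SW s i|) (#|NW s i|) (#|SE s i|) (#|NE s i|) e1 e2 e3 Q => A B C D e1 e2 e3 Q.
have hAC : (A == 0) || (C == 0).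
  apply/negP=> /negP hAC; apply: ct.
  (* Trading a kept SW point for an SE one lowers the horizontal rank from t + 1 to t and keeps the
     vertical rank a + c. The bounds a >= 1 and c < C leave room for the trade; the other terms make
     the NW and NE quadrants large enough. *)
  pose a := maxn 1 (t.+1 - B); pose c := minn C.-1 (n - t.+2).
  transitivity (colour P (a + c)).
    rewrite (_ : a + c = a.-1 + c.+1); last by lia.
    rewrite (_ : t = a.-1 + (t.+1 - a)); last by lia.
    by apply: (Q _ _ _ (n - t.+2 - c)); lia.
  rewrite (_ : t.+1 = a + (t.+1 - a)); last by lia.
  by symmetry; apply: (Q _ _ _ (n - t.+2 - c)); lia.
have hBD : (B == 0) || (D == 0).
  apply/negP=> /negP hBD; apply: ct.
  (* The same trade above the point, from NW to NE. *)
  pose b := maxn 1 (t.+1 - A); pose d := minn D.-1 (n - t.+2).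
  transitivity (colour P (t.+1 - b + (n - t.+2 - d))).
    rewrite [in LHS](_ : t = t.+1 - b + b.-1); last by lia.
    by apply: (Q _ _ _ d.+1); lia.
  rewrite [in RHS](_ : t.+1 = t.+1 - b + b); last by lia.
  by symmetry; apply: (Q _ _ _ d); lia.
(* Neither A = B = 0 nor C = D = 0 is possible: A + B = i > t, and C + D > 0 because i <= t + r and
   t + 1 < n. *)
lia.
Qed.

(** If x and [s x] lay in different blocks, some cut would have a straight point of its window
    between them; but [s] moves no point onto or across a straight one. *)
Lemma straight_stab (n r : nat) (P : {set {set 'I_n}}) (s : {perm 'I_(r + n)}) :
  0 < n -> 0 < r -> partition P [set: 'I_n] ->
  (forall t (i : 'I_(r + n)), cut P t -> t < i <= t + r -> straight s i) ->
  s \in stab_part (iter_part P r).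
Proof.
move=> n0 r0 pP h; apply/(stab_partP _ (iter_part_partition r n0 pP)) => x.
have mid (i : 'I_(r + n)) : straight s i ->
    (x < s x -> ~~ (x <= i <= s x)) /\ (s x < x -> ~~ (s x <= i <= x)).
  move=> si; have sii := straight_fixed si; move/straightP: si => /(_ x); rewrite sii.
  case: (ltngtP x i) => [||/val_inj e] *; first by lia.
    have : s x != i by rewrite -{1}sii (inj_eq perm_inj) -val_eqE /=; lia.
    by rewrite -val_eqE /=; lia.
  by move: sii; rewrite -e => ->; lia.
case: (ltngtP x (s x)) => [xs|sx|/val_inj <- //].
  symmetry; apply/(iter_part_pblockP n0 r0 pP xs) => t tn xt ty.
  apply/eqP/negPn/negP=> ct.
  (* The least i >= x with i > t. It is at most t + r because r > 0 and x <= t + r, and at most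
     [s x] because t < s x. *)
  have im : maxn t.+1 x < r + n by have := ltn_ord x; lia.
  have /mid : straight s (Ordinal im) by apply: (h t) => /=; rewrite /cut ?tn //; lia.
  by rewrite /= => -[]; lia.
apply/(iter_part_pblockP n0 r0 pP sx) => t tn xt ty.
apply/eqP/negPn/negP=> ct.
have im : maxn t.+1 (s x) < r + n by have := ltn_ord x; lia.
have /mid : straight s (Ordinal im) by apply: (h t) => /=; rewrite /cut ?tn //; lia.
by rewrite /= => -[]; lia.
Qed.

(** * Stabilisers of iterates are pattern-stable *)

(** Exactly r points are discarded, and each lowers the rank by at most one. *)
Lemma rank_val_bounds (r n : nat) (K : {set 'I_(r + n)}) (s : {perm 'I_(r + n)}) i :
  #|K| = n -> rank (val \o s) K i <= s i <= rank (val \o s) K i + r.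
Proof.
move=> Kn; rewrite -(card_perm_lt s i); apply/andP; split.
  by apply/subset_leq_card/subsetP=> k; rewrite !inE => /andP[].
rewrite -(cardsID K) setIC; apply: leq_add.
  by apply/subset_leq_card/subsetP=> k; rewrite !inE.
have Kr : #|~: K| = r by have := cardsC K; rewrite card_ord Kn; lia.
by rewrite -[X in _ <= X]Kr; apply/subset_leq_card/subsetP=> k; rewrite !inE => /andP[].
Qed.

Lemma rank_val1 (m : nat) (K : {set 'I_m}) (i : 'I_m) :
  rank val K i = rank (val \o (1%g : {perm 'I_m})) K i.
Proof. by apply: eq_card => k; rewrite !inE /= !perm1. Qed.

(** If [s] moves x, both ranks lie between min(x, s x) - r and max(x, s x), where the colour is
    constant since x and [s x] share a block of the iterate. *)
Lemma stab_pattern_stable (n r : nat) (P : {set {set 'I_n}}) (s : {perm 'I_(r + n)}) :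
  0 < n -> 0 < r -> partition P [set: 'I_n] ->
  s \in stab_part (iter_part P r) -> pattern_stable P s.
Proof.
move=> n0 r0 pP /(stab_partP _ (iter_part_partition r n0 pP)) hs K x Kn xK.
have p_bd : rank val K x <= x <= rank val K x + r.
  by rewrite rank_val1 -[X in _ <= X <= _](congr1 val (perm1 x)) rank_val_bounds.
have q_bd := rank_val_bounds s x Kn.
have pn : rank val K x < n by rewrite -[X in _ < X]Kn rank_bound.
have qn : rank (val \o s) K x < n by rewrite -[X in _ < X]Kn rank_bound.
have pq_eq (p q : nat) : p < n -> q < n -> 
    (forall t, t.+1 < n -> minn p q <= t < maxn p q -> colour P t = colour P t.+1) ->
    colour P p = colour P q.
  move=> ltpn ltqn h; case: (leqP p q) => pq.
    by apply: colour_path => // t ht; apply: h; lia.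
  by symmetry; apply: colour_path => [|t ht]; [lia | apply: h; lia].
have step (y z : 'I_(r + n)) : y < z -> pblock (iter_part P r) y = pblock (iter_part P r) z ->
    forall t, t.+1 < n -> y <= t + r -> t < z -> colour P t = colour P t.+1.
  by move=> yz /(iter_part_pblockP n0 r0 pP yz).
case: (ltngtP x (s x)) => [xs|sx|/val_inj/esym sxx].
- by apply: pq_eq => // t tn ht; apply: (step _ _ xs) => //; lia.
- by apply: pq_eq => // t tn ht; apply: (step _ _ sx) => //; lia.
rewrite sxx in q_bd.
(* At a fixed point x, a cut u with u < x <= u + r stops [s] from carrying any point across x, so
   the two ranks are equal. Without such a cut the colour is constant on [x - r, x], which contains
   both ranks. *)
case: (pickP [pred u : 'I_n | [&& cut P u, x <= u + r & u < x]]) => [t /= /and3P[]|no].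
  move=> /andP[tn /eqP ct] xt tx; congr (colour P _).
  apply: eq_card => k; rewrite !inE /= sxx; congr (_ && _).
  have kin := step k (s k); have kout := step (s k) k.
  case: (ltngtP k x) => [kx|xk|/val_inj->]; last by rewrite sxx ltnn.
    rewrite ltnNge; apply/esym/negP => xk.
    by apply: ct; apply: kin => //; rewrite ?hs //; lia.
  apply/esym/negbTE/negP => kx.
  by apply: ct; apply: kout => //; rewrite ?hs //; lia.
apply: pq_eq => // t tn ht; apply/eqP/negPn/negP => ct.
have := no (Ordinal (ltnW tn)); rewrite /= /cut tn ct /=; lia.
Qed.

(** * The reversal and the skew case *)

Lemma delta_stab_partP (n : nat) (P : {set {set 'I_n}}) :
  partition P [set: 'I_n] ->
  delta n \in stab_part P <->
  (forall t, t < n -> colour P t = colour P (n - t.+1)).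
Proof.
move=> pP; split=> [/(stab_partP _ pP) h t tn|h].
  by have := h (Ordinal tn); rewrite -!colour_ord permE.
by apply/(stab_partP _ pP) => x; rewrite -!colour_ord permE /= -h.
Qed.

(** Under the reversal the vertical rank counts the kept points after i, so the two ranks add up to
    n - 1. *)
Lemma delta_pattern_stable (n m : nat) (P : {set {set 'I_n}}) :
  partition P [set: 'I_n] -> delta n \in stab_part P -> pattern_stable P (delta m).
Proof.
move=> pP /(delta_stab_partP pP) sym K i Kn iK.
rewrite sym; last by rewrite -[X in _ < X]Kn rank_bound.
congr (colour P _); rewrite -[X in X - _]Kn (cardsD1 i) iK.
rewrite add1n subSS -(cardsID [set k : 'I_m | k < i] (K :\ i)).
have -> : #|(K :\ i) :&: [set k : 'I_m | k < i]| = rank val K i.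
  by apply: eq_card => k; rewrite !inE -val_eqE /=; case: ltngtP; rewrite ?andbF.
rewrite addKn; apply: eq_card => k; rewrite !inE -val_eqE /= !permE /=.
by have := ltn_ord i; have := ltn_ord k; case: (k \in K) => //=; lia.
Qed.

Lemma deltaK (m : nat) : (delta m * delta m = 1)%g.
Proof. by apply/permP=> x; rewrite permM !permE rev_ordK. Qed.

Lemma skew_delta (m : nat) (s : {perm 'I_m}) (i : 'I_m) :
  skew s i -> straight (s * delta m)%g i.
Proof.
move=> /skewP h; apply/straightP => k; rewrite h !permM !permE /=.
by have := ltn_ord (s i); have := ltn_ord (s k); lia.
Qed.

(** Only NW and SE are inhabited, so the two ranks add up to n - 1. The bound t < i leaves enough
    points on the left for rank t + 1, and i <= t + r enough on the right for rank t. *)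
Lemma skew_symmetric (n r : nat) (P : {set {set 'I_n}}) (s : {perm 'I_(r + n)})
    (t : nat) (i : 'I_(r + n)) :
  pattern_stable P s -> t.+1 < n -> t < i <= t + r -> skew s i ->
  colour P t = colour P (n - t.+1) /\ colour P t.+1 = colour P (n - t.+2).
Proof.
move=> hs tn ti; have [e1 e2 e3] := card_quadrants s i.
have Q a b c d := @pattern_stable_quadrants _ _ _ _ i a b c d hs.
rewrite skew_quadrants => /andP[/eqP SW0 /eqP NE0].
rewrite SW0 NE0 in Q e1 e3.
by split; [apply: (Q 0 t _ 0) | apply: (Q 0 t.+1 _ 0)]; lia.
Qed.

(** Symmetry of the colour at t passes to t + 1 and back: it holds at both if t is a cut, and
    otherwise neither t nor its mirror place n - t - 2 is a cut. The cut [t0] provides one place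
    where it holds. *)
Lemma delta_stab_of_cuts (n : nat) (P : {set {set 'I_n}}) (t0 : nat) :
  partition P [set: 'I_n] -> cut P t0 ->
  (forall t, cut P t ->
     colour P t = colour P (n - t.+1) /\ colour P t.+1 = colour P (n - t.+2)) ->
  delta n \in stab_part P.
Proof.
move=> pP ct0 h; pose Q t := colour P t == colour P (n - t.+1).
have step t : t.+1 < n -> Q t = Q t.+1.
  move=> tn; rewrite /Q; case: (eqVneq (colour P t) (colour P t.+1)) => [e|ne].
    rewrite e (_ : n - t.+1 = (n - t.+2).+1); last by lia.
    case: (eqVneq (colour P (n - t.+2)) (colour P (n - t.+2).+1)) => [-> //|ne].
    have cn : cut P (n - t.+2) by rewrite /cut ne andbT; lia.
    have [] := h _ cn; have -> : n - (n - t.+2).+1 = t.+1 by lia.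
    have -> : n - (n - t.+2).+2 = t by lia.
    by move=> e1 e2; rewrite e1 e2 e eqxx in ne.
  have ct : cut P t by rewrite /cut tn.
  by have [<- <-] := h _ ct; rewrite !eqxx.
have Q0 t : t < n -> Q t = Q 0.
  by elim: t => // t IHt tn; rewrite -step // IHt // ltnW.
have t0n : t0.+1 < n by case/andP: ct0.
apply/(delta_stab_partP pP) => t tn; apply/eqP; rewrite -/(Q t) Q0 // -(Q0 t0) ?(ltnW t0n) //.
by apply/eqP; case: (h _ ct0).
Qed.

Lemma pattern_stable_dichotomy (n r : nat) (P : {set {set 'I_n}}) (s : {perm 'I_(r + n)}) :
  0 < n -> 0 < r -> partition P [set: 'I_n] -> pattern_stable P s ->
  s \in stab_part (iter_part P r) \/
  delta n \in stab_part P /\ (s * delta (r + n))%g \in stab_part (iter_part P r).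
Proof.
move=> n0 r0 pP hs.
pose zone (i : 'I_(r + n)) := [exists t : 'I_n, cut P t && (t < i <= t + r)].
have zoneI (t : nat) (i : 'I_(r + n)) : cut P t -> t < i <= t + r -> zone i.
  move=> ct ti; have /andP[tn _] := ct.
  by apply/existsP; exists (Ordinal (ltnW tn)); rewrite /= ct.
have zoneP i : zone i -> straight s i || skew s i.
  by move=> /existsP[t /andP[ct ti]]; exact: (straight_or_skew hs ct ti).
case: (boolP [forall i, zone i ==> straight s i]) => [/forall_inP h|].
  left; apply: straight_stab => // t i ct ti; apply: h; exact: zoneI ct ti.
rewrite negb_forall_in => /exists_inP[j zj nsj].
have skj : skew s j by have := zoneP _ zj; rewrite (negPf nsj).
(* One skew point rules out straight points everywhere else. *)
have sk i : zone i -> skew s i.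
  move=> zi; case: (eqVneq i j) => [-> //|ij].
  have /orP[si|//] := zoneP _ zi.
  by have := straight_not_skew ij si; rewrite skj.
right; split; last first.
  by apply: straight_stab => // t i ct ti; apply/skew_delta/sk; exact: zoneI ct ti.
have /existsP[t0 /andP[ct0 _]] := zj.
apply: (delta_stab_of_cuts pP ct0) => t ct; have /andP[tn _] := ct.
(* As r > 0, the point t + 1 lies in the zone of the cut t. *)
have im : t.+1 < r + n by lia.
have ti : t < Ordinal im <= t + r by rewrite /=; lia.
by apply: (skew_symmetric hs tn ti); apply/sk; exact: zoneI ct ti.
Qed.

Theorem theorem4p9 (n : nat) (P : {set {set 'I_n}}) (i : nat)
    (n_gt0 : 0 < n) (P_part : partition P [set: 'I_n]) (i_gt0 : 0 < i) :
  Comp (i + n) (stab_part P) =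
    if delta n \notin stab_part P then stab_part (iter_part P i)
    else (<<stab_part (iter_part P i) :|: [set delta (i + n)]>>)%g.
Proof.
have stab_Comp s : s \in stab_part (iter_part P i) -> s \in Comp (i + n) (stab_part P).
  by move=> hs; apply/(CompP _ P_part); apply: stab_pattern_stable hs.
case: ifPn => [dP|/negPn dP]; apply/eqP; rewrite eqEsubset; apply/andP; split;
  apply/subsetP=> s.
- move=> /(CompP _ P_part)/(pattern_stable_dichotomy n_gt0 i_gt0 P_part)[//|[dn _]].
  by rewrite dn in dP.
- exact: stab_Comp.
- move=> /(CompP _ P_part)/(pattern_stable_dichotomy n_gt0 i_gt0 P_part)[hs|[_ hs]].
    by rewrite mem_gen // inE hs.
  (* The reversal is an involution, so [s] is the product of [s * delta] and [delta]. *)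
  rewrite -[s]mulg1 -(deltaK (i + n)) mulgA.
  by apply: groupM; apply: mem_gen; rewrite inE ?hs ?set11 ?orbT.
(* Since [Comp] is itself a group here, checking the generators is enough. *)
have grp : group_set (Comp (i + n) (stab_part P)).
  apply/group_setP; split=> [|u v].
    by apply: stab_Comp; apply/(stab_partP _ (iter_part_partition i n_gt0 P_part)) => x;
      rewrite perm1.
  by move=> /(CompP _ P_part) hu /(CompP _ P_part) hv; apply/(CompP _ P_part); exact: pattern_stableM.
have : (<<stab_part (iter_part P i) :|: [set delta (i + n)]>> \subset Group grp)%g.
  rewrite gen_subG subUset sub1set; apply/andP; split; first by apply/subsetP.
  by apply/(CompP _ P_part); exact: delta_pattern_stable.
by move/subsetP; apply.
Qed.
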